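(* Let $(B_1,\ldots,B_n) \sim \mu \in \mathcal{B}_n$. Then $\lambda(B_i,B_j) = P(B_i = B_j)$ for all $i < j$. For all distribution functions $F_1,\ldots,F_n$ with (finite) second moments, there exists a distribution for $(X_1,\ldots,X_n)$ such that for all $i$ we have $P(X_i \le x) = F_i(x)$ (for all real $x$), and for all $i < j$ we have $\lambda(X_i,X_j) = \lambda(B_i,B_j)$. Here $\lambda(\cdot,\cdot)$ denotes the convexity parameter.
   Context: $\mathcal{B}_n$ is the set of probabilities on $\{0,1\}^n$ such that if $(B_1,\ldots,B_n)\sim\mu$ where $\mu\in\mathcal{B}_n$, then $P(B_i=1)=1/2$ for all $i$. For a cumulative distribution function (cdf) $F$, the pseudoinverse is $F^{-1}(u) = \inf\{x : F(x)\ge u\}$. The correlation is $\operatorname{corr}(X,Y) = \frac{E[XY]-E[X]E[Y]}{\operatorname{sd}(X)\operatorname{sd}(Y)}$, for standard deviations $\operatorname{sd}(X)$ and $\operatorname{sd}(Y)$ that are finite. Convexity parameter: consider random variables $X$ and $Y$ with finite second moments, and cdfs $F_X$ and $F_Y$ respectively. For $U$ uniform on $[0,1]$, let $\rho^- = \operatorname{corr}(F_X^{-1}(U),F_Y^{-1}(1-U))$ and $\rho^+ = \operatorname{corr}(F_X^{-1}(U),F_Y^{-1}(U))$. By the Fréchet–Hoeffding bound, $\rho^-\le \operatorname{corr}(X,Y)\le\rho^+$, and there is a unique $\lambda\in[0,1]$ such that $\operatorname{corr}(X,Y) = \lambda\rho^+ + (1-\lambda)\rho^-$. This $\lambda=\lambda(X,Y)$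 is called the convexity parameter of $X$ and $Y$. *)

(* Defs.v *)
From HB Require Import structures.
From mathcomp Require Import all_boot all_order all_algebra.
From mathcomp Require Import all_classical all_reals all_analysis.

Set Implicit Arguments.
Unset Strict Implicit.
Unset Printing Implicit Defensive.
Import Order.TTheory GRing.Theory Num.Theory.
Import numFieldNormedType.Exports.

Local Open Scope classical_set_scope.
Local Open Scope ring_scope.

(* tnth itself takes the tuple first; this form carries the measurable-function
   instance needed to use a coordinate as a random variable. *)
Definition tuple_coord d (T : measurableType d) (n : nat) (i : 'I_n)
    (x : n.-tuple T) : T := tnth x i.

HB.instance Definition _ d (T : measurableType d) (n : nat) (i : 'I_n) :=
  isMeasurableFun.Build _ _ (n.-tuple T) T (@tuple_coord d T n i)
    (@measurable_tnth d T n i).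

Definition bit (R : realType) (b : bool) : R := b%:R.

Lemma measurable_bit (R : realType) : measurable_fun [set: bool] (@bit R).
Proof. by []. Qed.

HB.instance Definition _ (R : realType) :=
  isMeasurableFun.Build _ _ bool R (@bit R) (@measurable_bit R).

Definition Bern_half (R : realType) (n : nat) : set (probability (n.-tuple bool) R) :=
  [set mu | forall i : 'I_n, mu [set b | tnth b i = true] = (2^-1)%:E].

Section correlation.
Context d (T : measurableType d) (R : realType) (P : probability T R).

Definition sd (X : T -> R) : R := Num.sqrt (fine 'V_P[X]).

(* This is the correlation only when X and Y have finite second moments and
   nonzero variance (a zero denominator gives the value 0). *)
Definition corr (X Y : T -> R) : R :=
  (fine 'E_P[X * Y] - fine 'E_P[X] * fine 'E_P[Y]) / (sd X * sd Y).

End correlation.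

(* For a cdf F and u = 0 (or u = 1 with F < 1) the infimum is not a real number
   and inf takes a junk value; under the uniform law these u are negligible. *)
Definition pseudoinverse (R : realType) (F : R -> R) (u : R) : R :=
  inf [set x | u <= F x].

Section convexity_parameter.
Context d (T : measurableType d) (R : realType) (P : probability T R).

Definition quantile (X : {RV P >-> R}) : R -> R :=
  pseudoinverse (fun x => fine (cdf X x)).

Variables X Y : {RV P >-> R}.

(* The uniform variable U is the identity on (R, uniform_prob 0 1). *)
Definition rho_minus : R :=
  corr (uniform_prob (@ltr01 R)) (quantile X) (fun u => quantile Y (1 - u)).

Definition rho_plus : R :=
  corr (uniform_prob (@ltr01 R)) (quantile X) (quantile Y).

Definition is_convexity_parameter (l : R) : Prop :=
  0 <= l <= 1 /\ corr P X Y = l * rho_plus + (1 - l) * rho_minus.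

(* "The unique l such that ..."; the default -1 lies outside [0, 1], so a value
   in [0, 1] certifies that such an l exists and is unique. The value is -1
   when X or Y is almost surely constant, where the parameter is undefined. *)
Definition convexity_parameter : R :=
  xget (-1) [set l | unique is_convexity_parameter l].

End convexity_parameter.

Arguments quantile {d T R} P X _.
Arguments rho_minus {d T R} P X Y.
Arguments rho_plus {d T R} P X Y.
Arguments is_convexity_parameter {d T R} P X Y l.
Arguments convexity_parameter {d T R} P X Y.

(* Main.v *)
Require Import Defs.
From HB Require Import structures.
From mathcomp Require Import all_boot all_order all_algebra.
From mathcomp Require Import all_classical all_reals all_analysis.
From mathcomp Require Import measurable_realfun ring lra.
Set Implicit Arguments.
Unset Strict Implicit.
Unset Printing Implicit Defensive.
Import Order.TTheory GRing.Theory Num.Theory.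
Import numFieldNormedType.Exports.
Local Open Scope classical_set_scope.
Local Open Scope ring_scope.

(** The coupling: draw the bits [B] with law [mu] and, independently, one uniform
    [U]; let [X_i] be the quantile function of [F_i] evaluated at [U] when
    [B_i = 1] and at [1 - U] when [B_i = 0]. As [1 - U] is again uniform, [X_i]
    has cdf [F_i] whatever the bit. Two coordinates whose bits agree are driven
    by the same uniform and are comonotone; two whose bits differ are driven by
    [U] and [1 - U] and are antimonotone. Hence, with [p = P(B_i = B_j)],
    [E[X_i X_j] = p A + (1 - p) C], where [A] and [C] are the mixed moments that
    enter rho+ and rho-; the means and standard deviations being those of
    [X_i] and [X_j] in all three correlations,
    [corr (X_i, X_j) = p rho+ + (1 - p) rho-] ([coupling_product], [convexity_parameterE]).

    The parameter is defined by unique existence, so one also needs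
    [rho- < rho+], i.e. [C < A], when neither variable is degenerate. This is
    [comonotone_gt]: writing [f], [g] for the quantile functions, [2 (A - C)] is
    the mean of [(f(U) - f(1 - U)) (g(U) - g(1 - U))], whose factors have the
    same sign because [f] and [g] are nondecreasing, and are both nonzero for
    [U] close to 1 because [f] and [g] are not constant on (0, 1).

    The first claim rests on the same identity. For two fair bits the common
    quantile function [q] has [q ^ 2] of mean [1/2] and [q(u) q(1 - u) = 0] on
    (0, 1), so [A = 1/2] and [C = 0], while taking means in [1_(X = Y) = 1 - X - Y + 2 X Y] gives
    [E[X Y] = P(X = Y) / 2] ([convexity_parameter_fair_bit]). *)

(** * Quantile functions *)
Section quantile_function.
Context {R : realType} (F : cumulativeBounded (0 : R) (1 : R)).
Local Notation U := (uniform_prob (@ltr01 R)).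
Local Notation q := (pseudoinverse F).

(** The Galois connection between a cdf and its pseudoinverse. On (0, 1) the set
    defining the infimum is nonempty and bounded below because of the limits of
    [F] at infinity; right-continuity says that the infimum is attained. *)
Lemma pseudoinverse_le (u x : R) : 0 < u < 1 -> (q u <= x) = (u <= F x).
Proof.
move=> /andP[u0 u1].
have F_ub : \forall y \near +oo, u < F y.
  by have := cumulativey F; move/cvgr_gt; exact.
have F_lb : \forall y \near -oo, F y < u.
  by have := cumulativeNy F; move/cvgr_lt; exact.
have ne : [set y | u <= F y] !=set0.
  near (pinfty_nbhs R) => y; exists y => /=; apply: ltW; near: y; exact: F_ub.
have lb : has_lbound [set y | u <= F y].
  near (ninfty_nbhs R) => y; exists y => z /= uFz; rewrite leNgt; apply/negP => zy.
  have : F y < u by near: y; exact: F_lb.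
  by rewrite ltNge (le_trans uFz)// cumulative_is_nondecreasing// ltW.
apply/idP/idP => [qx|uFx]; last exact: ge_inf.
rewrite leNgt; apply/negP => Fxu.
have F_right : \forall y \near x^'+, F y < u.
  by have /cvgr_lt := @cumulative_is_right_continuous _ _ _ F x; apply.
near x^'+ => y.
have xy : x < y by near: y; exact: nbhs_right_gt.
have [z uFz zy] := inf_lt ne (le_lt_trans qx xy).
have : F y < u by near: y; exact: F_right.
by rewrite ltNge (le_trans uFz)// cumulative_is_nondecreasing// ltW.
Unshelve. all: by end_near. Qed.

Lemma pseudoinverse_nd (u v : R) : 0 < u -> u <= v -> v < 1 -> q u <= q v.
Proof.
move=> u0 uv v1; rewrite pseudoinverse_le; last by rewrite u0 (le_lt_trans uv).
by apply: (le_trans uv); rewrite -pseudoinverse_le ?lexx// v1 (lt_le_trans u0).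
Qed.

Lemma cumulative_ge0 (x : R) : 0 <= F x.
Proof.
rewrite leNgt; apply/negP => Fx0.
have F_lb : \forall y \near -oo, F x < F y.
  by have := cumulativeNy F; move/cvgr_gt; exact.
near (ninfty_nbhs R) => y.
have : F x < F y by near: y; exact: F_lb.
by rewrite ltNge cumulative_is_nondecreasing.
Unshelve. all: by end_near. Qed.

Lemma cumulative_le1 (x : R) : F x <= 1.
Proof.
rewrite leNgt; apply/negP => Fx1.
have F_ub : \forall y \near +oo, F y < F x.
  by have := cumulativey F; move/cvgr_lt; exact.
near (pinfty_nbhs R) => y.
have : F y < F x by near: y; exact: F_ub.
by rewrite ltNge cumulative_is_nondecreasing.
Unshelve. all: by end_near. Qed.

(** Outside ]0, 1] the infimum is taken over the whole line or over the empty
    set, hence the default value 0; this is needed to know that the quantile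
    function is measurable on the whole line and not only on (0, 1). *)
Lemma pseudoinverse_out (u : R) : ~~ (0 < u <= 1) -> q u = 0.
Proof.
move=> u01; apply: inf_out => -[[z /= uFz] [m mlb]]; move/negP: u01; apply.
rewrite (le_trans uFz (cumulative_le1 z)) andbT ltNge; apply/negP => u0.
have : m <= m - 1 by apply: mlb => /=; exact: le_trans u0 (cumulative_ge0 _).
by move=> ?; lra.
Qed.

Lemma measurable_pseudoinverse : measurable_fun [set: R] q.
Proof.
rewrite -(setUv `]0, 1[%classic); apply/measurable_funU => //.
  exact: measurableC.
split.
  apply: (measurability (@RGenOInfty.G R)) => [|/= _ [_] [x] -> <-].
    exact: RGenOInfty.measurableE.
  rewrite (_ : _ `&` _ = `]0, 1[ `&` `]F x, +oo[)%classic.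
    by apply: measurableI.
  apply/seteqP; split=> u /= []; rewrite !in_itv/= !andbT => u01.
    by rewrite ltNge pseudoinverse_le// -ltNge.
  by rewrite [_ < q u]ltNge pseudoinverse_le// -ltNge.
(* At 1 the infimum may or may not be a default value, so it is kept as is. *)
apply: (eq_measurable_fun (fun u : R => if u == 1 then q 1 else 0 : R)).
  move=> u; rewrite inE/= in_itv/= => /negP u01.
  case: eqP => [->//|/eqP u1]; rewrite pseudoinverse_out//.
  by apply: contra u01 => /andP[-> ?]; rewrite lt_neqAle u1.
apply: measurable_funTS; apply: measurable_fun_ifT => //.
exact: measurable_fun_eqr.
Qed.

(** The uniform law lives on [measurableTypeR R], whose measurable structure is
    convertible to the one of [R] but carries another display; the retyping is
    what makes the quantile function a random variable for that law. *)
Definition quantile_rv : measurableTypeR R -> R := q.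

HB.instance Definition _ := isMeasurableFun.Build _ _ (measurableTypeR R) R
  quantile_rv measurable_pseudoinverse.

End quantile_function.

(** * The uniform law and its reflection *)
Section uniform.
Context {R : realType}.
Local Notation U := (uniform_prob (@ltr01 R)).

(** The open interval is the convenient support: quantile functions take
    meaningful values there, and the two endpoints are negligible. *)
Lemma uniform_prob01E (A : set R) : measurable A ->
  U A = lebesgue_measure (A `&` `]0, 1[%classic).
Proof.
move=> mA; rewrite /uniform_prob integral_uniform_pdf.
have mAI : measurable (A `&` `[0, 1]%classic) by exact: measurableI.
rewrite (eq_integral (cst 1%E)); last first.
  by move=> x; rewrite inE/= in_itv/= /uniform_pdf => -[_ ->]; rewrite subr0 invr1.
rewrite integral_cst// mul1e.
have -> : A `&` `[0, 1]%classic
    = (A `&` `]0, 1[%classic) `|` (A `&` [set 0; 1]).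
  rewrite -setIUr; congr (_ `&` _); apply/seteqP; split=> x /=; rewrite !in_itv/=.
    rewrite !le_eqVlt => /andP[/orP[/eqP <-|x0] /orP[/eqP x1|x1]];
      by [rewrite x0 x1; left|right; rewrite ?x1; tauto].
  by case=> [/andP[/ltW -> /ltW ->//]|[->|->]]; rewrite lexx ler01.
have m01 : measurable ([set 0; 1] : set R) by exact: measurableU.
rewrite [LHS]measureU0//; try exact: measurableI.
apply: (@subset_measure0 _ _ _ lebesgue_measure _ [set 0; 1]) => //.
  exact: measurableI.
rewrite [LHS]measureU0//; exact: lebesgue_measure_set1.
Qed.

Lemma cdf_quantile_rv (F : cumulativeBounded (0 : R) (1 : R)) (x : R) :
  cdf (quantile_rv F : {RV U >-> R}) x = (F x)%:E.
Proof.
rewrite /cdf /distribution /pushforward /quantile_rv.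
have mA : measurable (pseudoinverse F @^-1` `]-oo, x]).
  by rewrite -[X in measurable X]setTI; exact: measurable_pseudoinverse.
rewrite [LHS]uniform_prob01E//.
have [F0 F1] := (cumulative_ge0 F x, cumulative_le1 F x).
have -> : pseudoinverse F @^-1` `]-oo, x] `&` `]0, 1[%classic
   = (`]0, 1[ `&` `]-oo, F x])%classic.
  rewrite setIC; apply/seteqP; split => u /= []; rewrite !in_itv/= => u01.
    by rewrite pseudoinverse_le.
  by rewrite pseudoinverse_le.
have [Fx1|Fx1] := ltP (F x) 1.
  rewrite (_ : _ `&` _ = `]0, F x]%classic); last first.
    apply/seteqP; split => u /=; rewrite !in_itv/=.
      by move=> [/andP[-> _] ->].
    by move=> /andP[-> uF]; split => //; exact: le_lt_trans uF Fx1.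
  rewrite lebesgue_measure_itv/= lte_fin; case: ltP => [|F0'].
    by rewrite -EFinB subr0.
  by congr (_%:E); apply/eqP; rewrite eq_le F0.
rewrite (_ : _ `&` _ = `]0, 1[%classic).
  rewrite lebesgue_measure_itv/= lte_fin ltr01 -EFinB subr0.
  by congr (_%:E); apply/eqP; rewrite eq_le F1 Fx1.
apply/seteqP; split => u /=; rewrite !in_itv/=; first by case.
move=> u01; split => //.
by case/andP: u01 => _ /ltW u1; exact: le_trans u1 Fx1.
Qed.

(** The antithetic variable, which is the one that defines rho-. *)
Definition flip (u : measurableTypeR R) : R := 1 - u.

Lemma measurable_flip : measurable_fun [set: R] flip.
Proof. exact: measurable_funB. Qed.

HB.instance Definition _ :=
  isMeasurableFun.Build _ _ (measurableTypeR R) R flip measurable_flip.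

Definition id_rv (u : measurableTypeR R) : R := u.

HB.instance Definition _ :=
  isMeasurableFun.Build _ _ (measurableTypeR R) R id_rv (@measurable_id _ R setT).

Lemma cdf_flip (x : R) :
  cdf (flip : {RV U >-> R}) x = cdf (id_rv : {RV U >-> R}) x.
Proof.
rewrite /cdf /distribution /pushforward /id_rv preimage_id.
have mA : measurable (flip @^-1` `]-oo, x]).
  by rewrite -[X in measurable X]setTI; exact: measurable_flip.
rewrite [LHS]uniform_prob01E// [RHS]uniform_prob01E//.
have [x0|x0] := leP x 0.
  rewrite (_ : _ `&` _ = set0); last first.
    rewrite -subset0 => u /=; rewrite !in_itv/= /flip => -[] *; lra.
  rewrite (_ : _ `&` _ = set0)//.
  rewrite -subset0 => u /=; rewrite !in_itv/= => -[] *; lra.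
have [x1|x1] := leP 1 x.
  congr lebesgue_measure; rewrite !setIidr// => u/=; rewrite !in_itv/= /flip; lra.
rewrite (_ : _ `&` _ = `[1 - x, 1[%classic); last first.
  apply/seteqP; split => u /=; rewrite !in_itv/= /flip; first by move=> []; lra.
  by move=> ?; split; lra.
rewrite (_ : `]-oo, x]%classic `&` _ = `]0, x]%classic); last first.
  apply/seteqP; split => u /=; rewrite !in_itv/=; first by move=> []; lra.
  by move=> ?; split; lra.
rewrite !lebesgue_measure_itv/= !lte_fin x0 ifT; last by lra.
by rewrite -!EFinB; congr EFin; ring.
Qed.

End uniform.

(** * A cdf determines all moments *)
Section equidistribution.
Context {R : realType}.

(** Transports a law on [R] to the display in which Lebesgue-Stieltjes measures
    are defined. *)
Definition to_measurableTypeR (x : R) : measurableTypeR R := x.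

HB.instance Definition _ := isMeasurableFun.Build _ _ R (measurableTypeR R)
  to_measurableTypeR (@measurable_id _ R setT).

(** Both measures give [F b - F a] to the interval ]a, b], and these intervals
    generate the Borel sets. *)
Lemma eq_cdf_measure (F : cumulative R R) (m : probability R R) :
  (forall x, m `]-oo, x]%classic = (F x)%:E) ->
  forall A, measurable A -> lebesgue_stieltjes_measure F A = m A.
Proof.
move=> mF A mA.
apply: (@lebesgue_stieltjes_measure_unique _ F
  (distribution m to_measurableTypeR)) => [I [[a b]]/= _ <- | //].
change (lebesgue_stieltjes_measure F `]a, b]%classic = m `]a, b]%classic).
rewrite /lebesgue_stieltjes_measure /measure_extension/=.
rewrite measurable_mu_extE/=; last exact: is_ocitv.
have [ab | ba] := leP a b; last first.
  by rewrite set_itv_ge ?wlength0 ?measure0// bnd_simp -leNgt ltW.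
rewrite wlength_itv_bnd// EFinB -!mF.
have -> : `]a, b]%classic = (`]-oo, b] `\` `]-oo, a])%classic.
  by rewrite -[RHS]setCK setCD setCitvl setUC -[LHS]setCK setCitv.
rewrite measureD ?setIidr//; first exact: subset_itvl.
by rewrite -ge0_fin_numE// fin_num_measure.
Qed.

(** The real-valued cdf, packaged as a cumulative function with limits 0 and 1 so
    that the facts on quantile functions and Lebesgue-Stieltjes measures apply to
    the law of an arbitrary random variable. *)
Definition rcdf d (T : measurableType d) (P : probability T R) (X : {RV P >-> R})
  (x : R) : R := fine (cdf X x).

Section rcdf.
Context d (T : measurableType d) (P : probability T R) (X : {RV P >-> R}).

Let rcdfE x : (rcdf X x)%:E = cdf X x.
Proof. by rewrite /rcdf fineK// fin_num_measure. Qed.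

Let rcdf_nd : nondecreasing (rcdf X).
Proof. by move=> x y xy; rewrite -lee_fin !rcdfE cdf_nondecreasing. Qed.

Let rcdf_rc : right_continuous (rcdf X).
Proof.
move=> a; apply: fine_cvg.
by rewrite fineK ?fin_num_measure//; exact: cdf_right_continuous.
Qed.

HB.instance Definition _ := isCumulative.Build R _ R (rcdf X) rcdf_nd rcdf_rc.

Let rcdf_Ny0 : rcdf X @ -oo --> (0 : R).
Proof. exact/fine_cvg/cvg_cdfNy0. Qed.

Let rcdf_y1 : rcdf X @ +oo --> (1 : R).
Proof. exact/fine_cvg/cvg_cdfy1. Qed.

HB.instance Definition _ :=
  isCumulativeBounded.Build R 0 1 (rcdf X) rcdf_Ny0 rcdf_y1.

End rcdf.

Lemma eq_cdf_distribution d1 (T1 : measurableType d1) (P1 : probability T1 R)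
    d2 (T2 : measurableType d2) (P2 : probability T2 R)
    (X1 : {RV P1 >-> R}) (X2 : {RV P2 >-> R}) :
  cdf X1 =1 cdf X2 ->
  forall A, measurable A -> distribution P1 X1 A = distribution P2 X2 A.
Proof.
move=> X12 A mA.
rewrite -(@eq_cdf_measure (rcdf X1) (distribution P1 X1))//; last first.
  by move=> x; rewrite /= fineK// fin_num_measure.
rewrite -(@eq_cdf_measure (rcdf X1) (distribution P2 X2))//.
by move=> x; rewrite /= fineK ?fin_num_measure// X12.
Qed.

Section transfer.
Context d1 (T1 : measurableType d1) (P1 : probability T1 R)
  d2 (T2 : measurableType d2) (P2 : probability T2 R)
  (X1 : {RV P1 >-> R}) (X2 : {RV P2 >-> R}).
Hypothesis X12 : cdf X1 =1 cdf X2.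

Let eq_cdf_ge0_integral (f : R -> \bar R) :
  measurable_fun [set: R] f -> (forall x, 0 <= f x)%E ->
  (\int[P1]_x f (X1 x) = \int[P2]_x f (X2 x))%E.
Proof.
move=> mf f0.
rewrite -[LHS](ge0_integral_distribution X1)// -[RHS](ge0_integral_distribution X2)//.
by apply: eq_measure_integral => A mA _; exact: eq_cdf_distribution.
Qed.

(** Each side is by definition the difference of the integrals of the positive
    and negative parts, so the nonnegative case suffices. *)
Lemma eq_cdf_integral (f : R -> \bar R) : measurable_fun [set: R] f ->
  (\int[P1]_x f (X1 x) = \int[P2]_x f (X2 x))%E.
Proof.
move=> mf; rewrite [LHS]integralE [RHS]integralE.
under [X in (X - _)%E = _]eq_integral do rewrite funepos_comp/=.
under [X in (_ - X)%E = _]eq_integral do rewrite funeneg_comp/=.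
under [X in _ = (X - _)%E]eq_integral do rewrite funepos_comp/=.
under [X in _ = (_ - X)%E]eq_integral do rewrite funeneg_comp/=.
congr (_ - _)%E.
  by apply: (@eq_cdf_ge0_integral (f^\+)%E) => //; exact: measurable_funepos.
by apply: (@eq_cdf_ge0_integral (f^\-)%E) => //; exact: measurable_funeneg.
Qed.

Lemma eq_cdf_expectation (g : R -> R) : measurable_fun [set: R] g ->
  ('E_P1[g \o X1] = 'E_P2[g \o X2])%E.
Proof.
move=> mg; rewrite unlock; apply: (@eq_cdf_integral (EFin \o g)).
exact/measurable_EFinP.
Qed.

Lemma eq_cdf_variance : ('V_P1[X1] = 'V_P2[X2])%E.
Proof.
have E12 : ('E_P1[X1] = 'E_P2[X2])%E.
  exact: (@eq_cdf_expectation (fun x : R => x) (@measurable_id _ R setT)).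
rewrite /variance unlock E12.
pose c := fine 'E_P2[X2]%E.
apply: (@eq_cdf_expectation (fun x : R => (x - c) * (x - c))).
by apply: measurable_funM; apply: measurable_funB.
Qed.

End transfer.

Lemma Lfun2_sqr_integralP d (T : measurableType d) (P : probability T R)
    (X : T -> R) : measurable_fun [set: T] X ->
  X \in Lfun P 2%:E <-> (\int[P]_x (X x ^+ 2)%:E < +oo)%E.
Proof.
move=> mX; split => [/Lfun2_integrable_sqr/integrable_lty|fin]; first exact.
rewrite inE; apply/andP; split; rewrite inE//= /finite_norm unlock /Lnorm.
apply: poweR_lty; under eq_integral.
  move=> x _ /=; rewrite powR_mulrn// -normrX ger0_norm ?sqr_ge0//; over.
exact: fin.
Qed.

Lemma eq_cdf_Lfun2 d1 (T1 : measurableType d1) (P1 : probability T1 R)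
    d2 (T2 : measurableType d2) (P2 : probability T2 R)
    (X1 : {RV P1 >-> R}) (X2 : {RV P2 >-> R}) : cdf X1 =1 cdf X2 ->
  (X1 : T1 -> R) \in Lfun P1 2%:E -> (X2 : T2 -> R) \in Lfun P2 2%:E.
Proof.
move=> X12 /Lfun2_sqr_integralP X1fin; apply/Lfun2_sqr_integralP => //.
rewrite -(@eq_cdf_integral _ _ _ _ _ _ _ _ X12 (fun x => (x ^+ 2)%:E)).
  exact: X1fin.
by apply/measurable_EFinP; exact: measurable_funX.
Qed.

End equidistribution.

(** * Strict gap between the comonotone and antimonotone moments *)
Section comonotone.
Context {R : realType}.
Local Notation U := (uniform_prob (@ltr01 R)).

Lemma expectation_flip (g : R -> R) : measurable_fun [set: R] g ->
  ('E_U[g \o flip] = 'E_U[g])%E.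
Proof.
move=> mg; rewrite -[RHS]/('E_U[g \o @id_rv R])%E.
exact: (@eq_cdf_expectation _ _ _ _ _ _ _ _ _ (@cdf_flip R) g mg).
Qed.

Lemma variance_flip (g : R -> R) : measurable_fun [set: R] g ->
  ('V_U[g \o flip] = 'V_U[g])%E.
Proof.
move=> mg; rewrite /variance unlock expectation_flip//.
pose c := fine 'E_U[g]%E.
apply: (@expectation_flip (fun u => (g u - c) * (g u - c))).
by apply: measurable_funM; apply: measurable_funB.
Qed.

Lemma Lfun2_flip (g : R -> R) :
  g \in Lfun U 2%:E -> g \o flip \in Lfun U 2%:E.
Proof.
move=> g2; have mg : measurable_fun [set: R] g.
  by move: g2; rewrite inE => /andP[/[!inE]].
apply/Lfun2_sqr_integralP; first exact: measurableT_comp mg measurable_flip.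
rewrite (@eq_cdf_integral _ _ _ _ _ _ _ _ _ (@cdf_flip R)
  (fun x => (g x ^+ 2)%:E)).
  by have /Lfun2_sqr_integralP := g2; exact.
by apply/measurable_EFinP; exact: measurable_funX.
Qed.

Lemma uniform_ae (Q : R -> Prop) : (forall u, 0 < u < 1 -> Q u) ->
  {ae U, forall u, Q u}.
Proof.
move=> HQ; exists (~` `]0, 1[%classic); split.
- exact: measurableC.
- rewrite uniform_prob01E; last exact: measurableC.
  by rewrite setICl measure0.
- by move=> u /= nQ u01; apply: nQ; apply: HQ; rewrite in_itv/= in u01.
Qed.

Lemma ae_eq_expectation (f g : R -> R) :
  measurable_fun [set: R] f -> measurable_fun [set: R] g ->
  (forall u, 0 < u < 1 -> f u = g u) -> ('E_U[f] = 'E_U[g])%E.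
Proof.
move=> mf mg fg; rewrite unlock; apply: ae_eq_integral => //.
- exact/measurable_EFinP.
- exact/measurable_EFinP.
- by apply: uniform_ae => u u01 _ /=; rewrite fg.
Qed.

(** If [q (1 - a) = q a] for all [a] in (1/2, 1), monotonicity squeezes [q] to a
    constant on (0, 1) and its variance vanishes. Otherwise strictness at one
    point [a] propagates to all [u >= a], again by monotonicity. *)
Lemma nondegenerate_quantile (F : cumulativeBounded (0 : R) (1 : R)) :
  (0 < 'V_U[pseudoinverse F])%E ->
  exists2 a, 2^-1 < a < 1 & forall u, a <= u < 1 ->
    pseudoinverse F (1 - u) < pseudoinverse F u.
Proof.
move=> V0; set q := pseudoinverse F in V0 *.
have nd := @pseudoinverse_nd _ F.
have [[a a12 qa]|noa] := pselect (exists2 a, 2^-1 < a < 1 & q (1 - a) < q a).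
  exists a => // u au; have := nd (1 - u) (1 - a); have := nd a u.
  rewrite -/q; lra.
have qcst u : 0 < u < 1 -> q u = q 2^-1.
  have half : (2^-1 : R) * 2 = 1 by rewrite mulVf.
  have sym a : 2^-1 < a < 1 -> q a <= q (1 - a).
    by move=> a12; rewrite leNgt; apply/negP => qa; apply: noa; exists a.
  move=> u01; have [u2|u2|->//] := ltgtP u 2^-1.
    have := sym (1 - u); have := nd u 2^-1; have := nd 2^-1 (1 - u).
    by rewrite subKr -/q; lra.
  have := sym u; have := nd 2^-1 u; have := nd (1 - u) 2^-1.
  by rewrite -/q; lra.
have mq : measurable_fun [set: R] q by exact: measurable_pseudoinverse.
suff : ('V_U[q] = 0)%E by move=> V; rewrite V ltxx in V0.
have Eq : ('E_U[q] = 'E_U[cst (q 2^-1%R)])%E by exact: ae_eq_expectation.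
rewrite /variance unlock Eq expectation_cst -[RHS](expectation_cst U 0).
apply: ae_eq_expectation => //.
  by apply: measurable_funM; apply: measurable_funB.
by move=> u u01 /=; rewrite !fctE/= qcst// subrr mul0r.
Qed.

(** Symmetrization: by invariance under [flip], twice the difference of the two
    moments is the mean of [(f - f o flip) (g - g o flip)], nonnegative on (0, 1)
    and positive on a neighbourhood of 1. *)
Lemma comonotone_gt (F G : cumulativeBounded (0 : R) (1 : R)) :
  let f := pseudoinverse F in let g := pseudoinverse G in
  f \in Lfun U 2%:E -> g \in Lfun U 2%:E -> (0 < 'V_U[f])%E -> (0 < 'V_U[g])%E ->
  ('E_U[f * (g \o flip)] < 'E_U[f * g])%E.
Proof.
move=> f g f2 g2 Vf Vg.
have f'2 := Lfun2_flip f2; have g'2 := Lfun2_flip g2.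
have mf : measurable_fun [set: R] f by exact: measurable_pseudoinverse.
have mg : measurable_fun [set: R] g by exact: measurable_pseudoinverse.
have mfl : measurable_fun [set: R] flip by exact: measurable_flip.
have mf' : measurable_fun [set: R] (f \o flip) by exact: measurableT_comp mf mfl.
have mg' : measurable_fun [set: R] (g \o flip) by exact: measurableT_comp mg mfl.
have fg1 := Lfun2_mul_Lfun1 f2 g2; have fg'1 := Lfun2_mul_Lfun1 f2 g'2.
have f'g1 := Lfun2_mul_Lfun1 f'2 g2; have f'g'1 := Lfun2_mul_Lfun1 f'2 g'2.
pose D : R -> R := (f \- (f \o flip)) * (g \- (g \o flip)).
have mD : measurable_fun [set: R] D.
  by apply: measurable_funM; apply: measurable_funB.
have ED : ('E_U[D] = ('E_U[f * g] - 'E_U[f * (g \o flip)]) *+ 2)%E.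
  have -> : D = ((f * g)%R \- (f * (g \o flip))%R) \+
      (((f \o flip) * (g \o flip))%R \- ((f \o flip) * g)%R).
    by apply/funext => u; rewrite /D !fctE/=; ring.
  rewrite expectationD; [|exact: rpredB|exact: rpredB].
  rewrite expectationB// expectationB//.
  have -> : ('E_U[(f \o flip) * (g \o flip)] = 'E_U[f * g])%E.
    rewrite -(@expectation_flip (f * g)%R)//; exact: measurable_funM.
  have -> : ('E_U[(f \o flip) * g] = 'E_U[f * (g \o flip)])%E.
    rewrite -(@expectation_flip (f * (g \o flip))%R); last exact: measurable_funM.
    congr expectation; apply/funext => u; rewrite !fctE/=; congr (_ * g _).
    by rewrite /flip subKr.
  by rewrite mule2n.
have [a a12 fa] := nondegenerate_quantile Vf.
have [b b12 gb] := nondegenerate_quantile Vg.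
have D_ge0 u : 0 < u < 1 -> 0 <= D u.
  move=> u01; rewrite /D !fctE /= /flip.
  have [u2|u2] := leP (1 - u) u.
    by apply: mulr_ge0; rewrite subr_ge0; apply: pseudoinverse_nd; lra.
  by apply: mulr_le0; rewrite subr_le0; apply: pseudoinverse_nd; lra.
have D_gt0 u : Num.max a b < u < 1 -> 0 < D u.
  rewrite gt_max => /andP[/andP[au bu] u1]; rewrite /D !fctE /= /flip.
  by apply: mulr_gt0; rewrite subr_gt0; [apply: fa|apply: gb]; rewrite ltW.
(* D may be negative outside (0, 1), where the quantiles are default values;
   there only the absolute value is usable, and it has the same mean. *)
have ED_abs : ('E_U[D] = \int[U]_u `|(D u)%:E|)%E.
  rewrite -[RHS]/(\int[U]_u (EFin \o (fun u => `|D u|%R)) u)%E.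
  rewrite (_ : (\int[U]_u _)%E = 'E_U[fun u => (`|D u|)%R]%E); last by rewrite unlock.
  apply: ae_eq_expectation => //; first exact: measurableT_comp.
  by move=> u /D_ge0 /ger0_norm.
suff ED_gt0 : (0 < 'E_U[D])%E.
  have fin1 := expectation_fin_num fg1; have fin2 := expectation_fin_num fg'1.
  move: ED_gt0; rewrite ED -(fineK fin1) -(fineK fin2) -EFinB mule2n -EFinD.
  by rewrite !lte_fin; lra.
rewrite lt0e ED_abs integral_ge0// andbT; apply/eqP => absD0.
have mED : measurable_fun [set: R] (EFin \o D) by exact/measurable_EFinP.
have [N [mN N0 subN]] := (ae_eq_integral_abs U measurableT mED).1 absD0.
have : (U `]Num.max a b, 1%R[%classic <= U N)%E.
  apply: le_measure; rewrite ?inE// => u /=; rewrite in_itv/= => abu; apply: subN => /=.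
  move=> /(_ I) /eqP; rewrite eqe; apply/negP.
  by rewrite gt_eqF// D_gt0.
rewrite N0 uniform_prob01E// setIidl; last first.
  move=> u /=; rewrite !in_itv/= gt_max => /andP[/andP[au _] ->]; rewrite andbT.
  by apply: lt_trans au; lra.
have ab1 : Num.max a b < 1 by rewrite gt_max; lra.
by rewrite lebesgue_measure_itv/= lte_fin ab1 -EFinB lee_fin; lra.
Qed.

End comonotone.

(** * Identifying the convexity parameter *)
Section convexity_parameter.
Context {R : realType} d (T : measurableType d) (P : probability T R).
Local Notation U := (uniform_prob (@ltr01 R)).
Variables X Y : {RV P >-> R}.

Lemma cdf_quantile (Z : {RV P >-> R}) :
  cdf (quantile_rv (rcdf Z) : {RV U >-> R}) =1 cdf Z.
Proof. by move=> x; rewrite cdf_quantile_rv /= fineK// fin_num_measure. Qed.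

(** The quantile transforms have the means and variances of [X] and [Y], so the
    correlation is an affine function of the mixed moment alone, and the
    hypothesis on [E[X Y]] says that [p] solves the defining equation. The
    solution is unique because [comonotone_gt] makes rho+ and rho- distinct. *)
Lemma convexity_parameterE (p : R) : 0 <= p <= 1 ->
  (X : T -> R) \in Lfun P 2%:E -> (Y : T -> R) \in Lfun P 2%:E ->
  (0 < 'V_P[X])%E -> (0 < 'V_P[Y])%E ->
  fine 'E_P[X * Y]%E = p * fine 'E_U[quantile P X * quantile P Y]%E
    + (1 - p) * fine 'E_U[quantile P X * (quantile P Y \o flip)]%E ->
  convexity_parameter P X Y = p.
Proof.
move=> p01 X2 Y2 VX VY EXY.
have qXX := cdf_quantile X; have qYY := cdf_quantile Y.
set qX := quantile P X in EXY *; set qY := quantile P Y in EXY *.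
have EX : ('E_U[qX] = 'E_P[X])%E.
  exact: (@eq_cdf_expectation _ _ _ _ _ _ _ _ _ qXX (fun x => x)).
have EY : ('E_U[qY] = 'E_P[Y])%E.
  exact: (@eq_cdf_expectation _ _ _ _ _ _ _ _ _ qYY (fun x => x)).
have VqX : ('V_U[qX] = 'V_P[X])%E by exact: (eq_cdf_variance qXX).
have VqY : ('V_U[qY] = 'V_P[Y])%E by exact: (eq_cdf_variance qYY).
have mqY : measurable_fun [set: R] qY := measurable_pseudoinverse (rcdf Y).
have EYf : ('E_U[qY \o flip] = 'E_P[Y])%E by rewrite expectation_flip.
have VqYf : ('V_U[qY \o flip] = 'V_P[Y])%E by rewrite variance_flip.
have qX2 : qX \in Lfun U 2%:E := eq_cdf_Lfun2 (fsym qXX) X2.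
have qY2 : qY \in Lfun U 2%:E := eq_cdf_Lfun2 (fsym qYY) Y2.
have sdX : 0 < sd P X.
  by rewrite sqrtr_gt0 fine_gt0// VX ltey_eq variance_fin_num.
have sdY : 0 < sd P Y.
  by rewrite sqrtr_gt0 fine_gt0// VY ltey_eq variance_fin_num.
set A := fine 'E_U[qX * qY]%E in EXY; set C := fine 'E_U[qX * (qY \o flip)]%E in EXY.
have CA : C < A.
  have qf2 := Lfun2_flip qY2.
  rewrite -lte_fin !fineK.
  - apply: (@comonotone_gt _ (rcdf X) (rcdf Y)) => //.
      by rewrite -VqX in VX.
    by rewrite -VqY in VY.
  - exact/expectation_fin_num/Lfun2_mul_Lfun1.
  - exact/expectation_fin_num/Lfun2_mul_Lfun1.
pose m := fine 'E_P[X]%E * fine 'E_P[Y]%E.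
pose s := sd P X * sd P Y.
have s_gt0 : 0 < s by exact: mulr_gt0.
have rhop : rho_plus P X Y = (A - m) / s.
  by rewrite /rho_plus /corr /sd EX EY VqX VqY.
have rhom : rho_minus P X Y = (C - m) / s.
  rewrite /rho_minus -[fun u => _]/(qY \o flip).
  by rewrite /corr /sd EX EYf VqX VqYf.
have param l : is_convexity_parameter P X Y l <-> 0 <= l <= 1 /\ l = p.
  rewrite /is_convexity_parameter rhop rhom /corr EXY -/m -/s.
  split=> -[l01 El]; split => //; last by rewrite El; ring.
  apply: (mulIf (x := (A - C) / s)).
    by rewrite mulf_neq0 ?invr_eq0 ?subr_eq0 ?gt_eqF.
  have -> : l * ((A - C) / s) = (l * ((A - m) / s) + (1 - l) * ((C - m) / s))
    - (C - m) / s by ring.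
  by rewrite -El; ring.
apply: xget_unique => [|l [/param[_ ->//]]].
by split; [apply/param|move=> l /param[_ ->]].
Qed.

End convexity_parameter.

(** * Fair bits *)
Section bernoulli.
Context {R : realType} d (T : measurableType d) (P : probability T R).
Local Notation U := (uniform_prob (@ltr01 R)).

Definition fair_bit (X : {RV P >-> R}) : Prop :=
  (forall t, X t = 0 \/ X t = 1) /\ P [set t | X t = 1] = (2^-1)%:E.

Lemma measurable_eq_RV (X Y : {RV P >-> R}) : measurable [set t | X t = Y t].
Proof.
rewrite (_ : [set t | _] = (fun t => X t == Y t) @^-1` [set true]).
  by rewrite -[X in measurable X]setTI; apply: measurable_fun_eqr.
by apply/seteqP; split => t /=; [move=> ->; rewrite eqxx|move=> /eqP].
Qed.

Lemma fair_bit_Lfun2 (X : {RV P >-> R}) : fair_bit X ->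
  (X : T -> R) \in Lfun P 2%:E.
Proof.
move=> [X01 _]; apply/Lfun2_sqr_integralP => //.
apply: (@le_lt_trans _ _ (\int[P]_x cst 1 x)%E).
  apply: ge0_le_integral => //=.
  - by move=> t _; rewrite lee_fin sqr_ge0.
  - by apply/measurable_EFinP; exact: measurable_funX.
  - by move=> t _; rewrite lee_fin; case: (X01 t) => ->; lra.
by rewrite integral_cst// mul1e (le_lt_trans (probability_le1 _ _))// ltry.
Qed.

Lemma fair_bit_expectation (X : {RV P >-> R}) : fair_bit X ->
  ('E_P[X] = (2^-1)%:E)%E.
Proof.
move=> [X01 XP]; rewrite -XP -expectation_indic; last first.
  exact: (measurable_eq_RV X (cst 1)).
congr expectation; apply/funext => t; rewrite indicE.
by case: (X01 t) => Xt; [rewrite memNset//= Xt => /eqP; rewrite eq_sym oner_eq0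
  |rewrite mem_set//=].
Qed.

Lemma fair_bit_sqr (X : {RV P >-> R}) : fair_bit X -> (X : T -> R) * X = X.
Proof.
move=> [X01 _]; apply/funext => t; rewrite !fctE.
by case: (X01 t) => ->; rewrite ?mulr0 ?mulr1.
Qed.

Lemma fair_bit_variance (X : {RV P >-> R}) : fair_bit X -> (0 < 'V_P[X])%E.
Proof.
move=> bX; rewrite varianceE; last exact: fair_bit_Lfun2.
rewrite expr2 fair_bit_sqr// fair_bit_expectation// -EFin_expe -EFinB lte_fin; lra.
Qed.

Lemma fair_bit_cdf (X : {RV P >-> R}) x : fair_bit X ->
  cdf X x = (if x < 0 then 0 else if x < 1 then 2^-1 else 1)%:E.
Proof.
move=> [X01 XP]; rewrite /cdf /distribution /pushforward.
have mX1 : measurable [set t | X t = 1] by exact: (measurable_eq_RV X (cst 1)).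
case: ltP => x0; last case: ltP => x1.
- rewrite (_ : _ @^-1` _ = set0) ?measure0// -subset0 => t /=; rewrite in_itv/=.
  by case: (X01 t) => ->; lra.
- rewrite (_ : _ @^-1` _ = ~` [set t | X t = 1]).
    by rewrite probability_setC// XP -EFinB; congr EFin; lra.
  by apply/seteqP; split => t /=; rewrite in_itv/=; case: (X01 t) => ->; lra.
- rewrite (_ : _ @^-1` _ = setT) ?probability_setT//.
  apply/seteqP; split => t //= _; rewrite in_itv/=.
  by case: (X01 t) => ->; lra.
Qed.

Lemma fair_bit_quantile0 (X : {RV P >-> R}) u : fair_bit X ->
  0 < u <= 2^-1 -> quantile P X u = 0.
Proof.
move=> bX u01; have u1 : 0 < u < 1 by lra.
have qle x : (quantile P X u <= x) = (u <= rcdf X x).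
  exact: (@pseudoinverse_le _ (rcdf X)).
apply/eqP; rewrite eq_le qle /rcdf fair_bit_cdf//= ltxx ltr01.
apply/andP; split; first by lra.
rewrite leNgt; apply/negP => q0.
by have := qle (quantile P X u); rewrite lexx /rcdf fair_bit_cdf//= q0; lra.
Qed.

(** Two fair bits have the same quantile function, so their comonotone moment is
    [E[X ^ 2] = 1/2]; their antimonotone moment is 0, since one of [u] and
    [1 - u] is at most 1/2, where the quantile function vanishes. *)
Lemma convexity_parameter_fair_bit (X Y : {RV P >-> R}) :
  fair_bit X -> fair_bit Y ->
  (convexity_parameter P X Y)%:E = P [set t | X t = Y t].
Proof.
move=> bX bY; set E := [set t | X t = Y t].
have mE : measurable E by exact: measurable_eq_RV.
have X2 := fair_bit_Lfun2 bX; have Y2 := fair_bit_Lfun2 bY.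
have Pfin : P setT \is a fin_num := fin_num_measure P _ measurableT.
have X1 := Lfun_subset12 Pfin X2; have Y1 := Lfun_subset12 Pfin Y2.
have XY1 := Lfun2_mul_Lfun1 X2 Y2.
have PE : (P E = 2%:E * 'E_P[(X : T -> R) * Y])%E.
  rewrite -expectation_indic//.
  have -> : (\1_E : T -> R) = ((cst 1 \- X) \- Y) \+ 2 \o* ((X : T -> R) * Y).
    apply/funext => t; rewrite indicE /= !fctE.
    case: (bX.1 t) => Xt; case: (bY.1 t) => Yt.
    - by rewrite mem_set /E/= ?Xt ?Yt//; ring.
    - by rewrite memNset /E/= ?Xt ?Yt; [ring|move/eqP; rewrite eq_sym oner_eq0].
    - by rewrite memNset /E/= ?Xt ?Yt; [ring|move/eqP; rewrite oner_eq0].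
    - by rewrite mem_set /E/= ?Xt ?Yt//; ring.
  rewrite expectationD; [|by rewrite !rpredB// Lfun_cst|exact: Lfun_scale].
  rewrite expectationB; [|by rewrite !rpredB// Lfun_cst|by []].
  rewrite expectationB; [|exact: Lfun_cst|by []].
  rewrite expectationZl// expectation_cst (fair_bit_expectation bX).
  rewrite (fair_bit_expectation bY) -!EFinB (_ : 1 - 2^-1 - 2^-1 = 0) ?add0e//.
  by lra.
have qXY : quantile P X = quantile P Y.
  by congr pseudoinverse; apply/funext => x; rewrite !fair_bit_cdf.
suff -> : convexity_parameter P X Y = fine (P E) by rewrite fineK ?fin_num_measure.
apply: convexity_parameterE => //.
- by rewrite -!lee_fin fineK ?fin_num_measure// measure_ge0 probability_le1.
- exact: fair_bit_variance.
- exact: fair_bit_variance.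
have -> : ('E_U[quantile P X * quantile P Y] = (2^-1)%:E)%E.
  rewrite -qXY -(fair_bit_expectation bX) -[in RHS](fair_bit_sqr bX).
  apply: (@eq_cdf_expectation _ _ _ _ _ _ _ _ _ (cdf_quantile X) (fun x => x * x)).
  exact: measurable_funM.
have -> : ('E_U[quantile P X * (quantile P Y \o flip)] = 0)%E.
  rewrite -[RHS](expectation_cst U 0) -qXY; apply: ae_eq_expectation => //.
  - apply: measurable_funM; first exact: (measurable_pseudoinverse (rcdf X)).
    exact: (measurableT_comp (measurable_pseudoinverse (rcdf X)) (@measurable_flip R)).
  - move=> u u01; rewrite !fctE /= /flip; have [u2|u2] := leP u 2^-1.
      by rewrite fair_bit_quantile0 ?mul0r//; lra.
    by rewrite (@fair_bit_quantile0 _ (1 - u)) ?mulr0//; lra.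
rewrite PE fineM ?expectation_fin_num//=; lra.
Qed.

End bernoulli.

(** * The coupling *)
Section coupling.
Context {R : realType} (n : nat) (mu : probability (n.-tuple bool) R)
  (F : 'I_n -> cumulativeBounded (0 : R) (1 : R)).
Local Notation U := (uniform_prob (@ltr01 R)).
Local Notation q i := (pseudoinverse (F i)).

Definition coupled_quantiles (z : n.-tuple bool * measurableTypeR R) : n.-tuple R :=
  [tuple q i (if tnth z.1 i then z.2 else flip z.2) | i < n].

Lemma measurable_coupled_quantiles : measurable_fun setT coupled_quantiles.
Proof.
apply/measurable_fun_tnthP => i.
rewrite (_ : _ \o _ = q i \o
  (fun z : n.-tuple bool * measurableTypeR R => if tnth z.1 i then z.2 else flip z.2)).
  apply: measurableT_comp; first exact: measurable_pseudoinverse.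
  apply: measurable_fun_ifT.
  - exact: (measurableT_comp (@measurable_tnth _ bool n i) measurable_fst).
  - exact: measurable_snd.
  - exact: (measurableT_comp (@measurable_flip R) measurable_snd).
by apply/funext => z; rewrite /= tnth_mktuple.
Qed.

HB.instance Definition _ := isMeasurableFun.Build _ _
  (n.-tuple bool * measurableTypeR R)%type (n.-tuple R)
  coupled_quantiles measurable_coupled_quantiles.

Local Notation Q := (mu \x U)%E.

Definition coupling : probability (n.-tuple R) R :=
  distribution Q coupled_quantiles.

Local Notation coord i := (@tuple_coord _ _ n i : {RV coupling >-> R}).

(** Conditionally on the bits, the coordinate is the quantile function at [U] or
    at [1 - U], and both have cdf [F i]. *)
Lemma cdf_coupling i x : cdf (coord i) x = (F i x)%:E.
Proof.
rewrite /cdf /distribution /coupling /pushforward /=.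
rewrite /distribution /pushforward /product_measure1.
transitivity (\int[mu]_b cst (F i x)%:E b)%E; last first.
  by rewrite integral_cst//= probability_setT mule1.
apply: eq_integral => b _ /=.
case bi : (tnth b i).
  rewrite -cdf_quantile_rv /cdf /distribution /pushforward.
  congr (uniform_prob _ _); apply/seteqP; split => u /=; rewrite /xsection/= inE/=;
    by rewrite /tuple_coord tnth_mktuple /= bi.
rewrite -cdf_quantile_rv.
have -> : cdf (quantile_rv (F i) : {RV U >-> R}) x =
   (U ((q i \o flip) @^-1` `]-oo, x]%classic)).
  have mA : measurable (q i @^-1` `]-oo, x]%classic).
    by rewrite -[X in measurable X]setTI; exact: measurable_pseudoinverse.
  exact/esym/(eq_cdf_distribution (@cdf_flip R) mA).
congr (uniform_prob _ _); apply/seteqP; split => u /=; rewrite /xsection/= inE/=;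
    by rewrite /tuple_coord tnth_mktuple /= bi.
Qed.

Lemma quantile_coupling i : quantile coupling (coord i) = q i.
Proof.
by congr pseudoinverse; apply/funext => x; rewrite cdf_coupling.
Qed.

Hypothesis F2 : forall i,
  (\int[lebesgue_stieltjes_measure (F i)]_x (x ^+ 2)%:E < +oo)%E.

(** The identity is a random variable with cdf [F i] for the Lebesgue-Stieltjes
    measure of [F i], and it is square-integrable by [F2]. *)
Lemma coupling_Lfun2 i : (coord i : n.-tuple R -> R) \in Lfun coupling 2%:E.
Proof.
pose L := lebesgue_stieltjes_measure (F i).
have id2 : @id_rv R \in Lfun L 2%:E by apply/Lfun2_sqr_integralP => //; exact: F2.
apply: (@eq_cdf_Lfun2 _ _ _ L _ _ _ (@id_rv R : {RV L >-> R})) id2 => x.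
by rewrite cdf_coupling -cdf_lebesgue_stieltjes_id.
Qed.

Lemma quantile_Lfun2 i : q i \in Lfun U 2%:E.
Proof.
have := @eq_cdf_Lfun2 _ _ _ coupling _ _ U (coord i) (quantile_rv (F i)).
by apply; [move=> x; rewrite cdf_coupling cdf_quantile_rv|exact: coupling_Lfun2].
Qed.

Lemma measurable_bits_eq (i j : 'I_n) :
  measurable [set b : n.-tuple bool | tnth b i = tnth b j].
Proof.
pose A k := [set b : n.-tuple bool | tnth b k = true].
have mA k : measurable (A k).
  rewrite -[X in measurable X]setTI.
  exact: (@measurable_tnth _ bool n k measurableT [set true]).
rewrite (_ : [set b | _] = (A i `&` A j) `|` (~` A i `&` ~` A j)).
  by apply: measurableU; apply: measurableI => //; exact: measurableC.
apply/seteqP; split => b; rewrite /A /=.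
  by move=> ->; case: (tnth b j); [left|right].
by case: (tnth b i); case: (tnth b j) => // -[[]|[]].
Qed.

(** Fubini: for fixed bits, the integral over the uniform variable is the
    comonotone moment if the bits agree and the antimonotone one otherwise, where
    [flip] exchanges the two subcases that share a moment. *)
Lemma coupling_product i j :
  let p := fine (mu [set b | tnth b i = tnth b j]) in
  fine 'E_coupling[(coord i : _ -> R) * coord j]%E =
    p * fine 'E_U[q i * q j]%E + (1 - p) * fine 'E_U[q i * (q j \o flip)]%E.
Proof.
move=> p; set E := [set b : n.-tuple bool | tnth b i = tnth b j].
have mE : measurable E by exact: measurable_bits_eq.
set A := fine 'E_U[q i * q j]%E; set C := fine 'E_U[q i * (q j \o flip)]%E.
have qi2 := quantile_Lfun2 i; have qj2 := quantile_Lfun2 j.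
have mqi := measurable_pseudoinverse (F i).
have mqj := measurable_pseudoinverse (F j).
have mfl := @measurable_flip R.
have finA : ('E_U[q i * q j] = A%:E)%E.
  by rewrite fineK//; exact/expectation_fin_num/Lfun2_mul_Lfun1.
have finC : ('E_U[q i * (q j \o flip)] = C%:E)%E.
  rewrite fineK//; apply/expectation_fin_num/Lfun2_mul_Lfun1 => //.
  exact: Lfun2_flip.
pose h (z : n.-tuple bool * measurableTypeR R) : R :=
  q i (if tnth z.1 i then z.2 else flip z.2) * q j (if tnth z.1 j then z.2 else flip z.2).
have Z2 k : (fun z => tnth (coupled_quantiles z) k) \in Lfun Q 2%:E.
  by apply: (@eq_cdf_Lfun2 _ _ _ coupling _ _ Q (coord k)
    (@tuple_coord _ _ n k \o coupled_quantiles)) => //; exact: coupling_Lfun2.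
have h_int : Q.-integrable setT (EFin \o h).
  have -> : h = (fun z => tnth (coupled_quantiles z) i) \*
      (fun z => tnth (coupled_quantiles z) j).
    by apply/funext => z; rewrite /h /= !tnth_mktuple.
  exact/Lfun1_integrable/Lfun2_mul_Lfun1.
have hE : 'E_coupling[(coord i : _ -> R) * coord j]%E = (\int[Q]_z (h z)%:E)%E.
  rewrite unlock [LHS](@integral_distribution _ _ _ _ _ _ coupled_quantiles
    (fun x => (tnth x i * tnth x j)%:E)).
  - by apply: eq_integral => z _; rewrite /h /= !tnth_mktuple.
  - by apply/measurable_EFinP/measurable_funM; exact: measurable_tnth.
  - by apply: eq_integrable h_int => // z _; rewrite /h /= !tnth_mktuple.
have inner b : (\int[U]_u (h (b, u))%:E = (C + (A - C) * \1_E b)%:E)%E.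
  have mqq : measurable_fun [set: R] (q i * q j) by exact: measurable_funM.
  have mqf : measurable_fun [set: R] (q i * (q j \o flip)).
    by apply: measurable_funM => //; exact: measurableT_comp.
  transitivity ('E_U[if tnth b i == tnth b j then (q i * q j)%R
                     else (q i * (q j \o flip))%R])%E.
    case: (boolP (tnth b i == tnth b j)) => [/eqP bij|bij].
      case bj : (tnth b j); last rewrite -(expectation_flip mqq);
        by rewrite unlock; apply: eq_integral => u _; rewrite /h/= bij bj.
    case bi : (tnth b i).
      rewrite unlock; apply: eq_integral => u _; rewrite /h/= bi.
      by move: bij; rewrite bi; case: (tnth b j).
    rewrite -(expectation_flip mqf) unlock; apply: eq_integral => u _; rewrite /h/= bi.
    by move: bij; rewrite bi; case: (tnth b j) => // _; rewrite !fctE /= /flip subKr.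
  case: (boolP (tnth b i == tnth b j)) => [/eqP bij|/eqP bij].
    by rewrite finA indicE mem_set// mulr1; congr EFin; ring.
  by rewrite finC indicE memNset// mulr0 addr0.
have -> : 'E_coupling[(coord i : _ -> R) * coord j]%E =
    'E_mu[cst C \+ (A - C) \o* \1_E]%E.
  rewrite hE -integral12_prod_meas1.
    rewrite unlock; apply: eq_integral => b _; rewrite /fubini_F inner.
    by rewrite /= mulrC.
  exact: h_int.
rewrite expectationD; [|exact: Lfun_cst|]; last first.
  by rewrite Lfun_scale//; apply/Lfun1_integrable/integrable_indic.
rewrite expectationZl; last by apply/Lfun1_integrable/integrable_indic.
rewrite expectation_cst expectation_indic//.
rewrite -(@fineK _ (mu E)) ?fin_num_measure// -/p -EFinM -EFinD /=; ring.
Qed.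

End coupling.

Unset Implicit Arguments.

Theorem theorem2 (R : realType) (n : nat)
    (mu : probability (n.-tuple bool) R) (hmu : Bern_half mu)
    (d : measure_display) (T : measurableType d) (P : probability T R)
    (B : {RV P >-> n.-tuple bool})
    (hB : forall A : set (n.-tuple bool), measurable A ->
      distribution P B A = mu A) :
  let Bc (i : 'I_n) : {RV P >-> R} := (@bit R \o (@tuple_coord _ _ n i \o B)) in
  (forall i j : 'I_n, (i < j)%N ->
    (convexity_parameter P (Bc i) (Bc j))%:E = P [set t | Bc i t = Bc j t]) /\
  (forall F : 'I_n -> cumulativeBounded (0 : R) (1 : R),
    (forall i : 'I_n,
      (\int[lebesgue_stieltjes_measure (F i)]_x (x ^+ 2)%:E < +oo)%E) ->
    exists nu : probability (n.-tuple R) R,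
      let X (i : 'I_n) : {RV nu >-> R} := @tuple_coord _ _ n i in
      (forall (i : 'I_n) (x : R), cdf (X i) x = (F i x)%:E) /\
      (forall i j : 'I_n, (i < j)%N ->
        (0 < 'V_nu[X i])%E -> (0 < 'V_nu[X j])%E ->
        convexity_parameter nu (X i) (X j) =
          convexity_parameter P (Bc i) (Bc j))).
Proof.
move=> Bc.
have bitE i t : Bc i t = (tnth (B t) i)%:R by [].
have fairB i : fair_bit (Bc i).
  split=> [t|]; first by rewrite bitE; case: (tnth _ _); [right|left].
  rewrite -(hmu i) -hB; last first.
    rewrite -[X in measurable X]setTI.
    exact: (@measurable_tnth _ bool n i measurableT [set true]).
  congr (P _); apply/seteqP; split=> t /=; rewrite /bit /tuple_coord.
    by case: (tnth _ _) => // /eqP; rewrite eq_sym oner_eq0.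
  by move=> ->.
have agreeE i j : P [set t | Bc i t = Bc j t] = mu [set b | tnth b i = tnth b j].
  rewrite -hB; last exact: measurable_bits_eq.
  congr (P _); apply/seteqP; split=> t /=; rewrite /bit /tuple_coord; last by move=> ->.
  by case: (tnth _ i); case: (tnth _ j) => // /eqP; rewrite ?oner_eq0// eq_sym oner_eq0.
split=> [i j _|F F2]; first exact: convexity_parameter_fair_bit.
exists (coupling mu F) => X; split=> [i x|i j _ Vi Vj]; first exact: cdf_coupling.
have -> : convexity_parameter P (Bc i) (Bc j) =
    fine (mu [set b | tnth b i = tnth b j]).
  by rewrite -agreeE -convexity_parameter_fair_bit.
apply: convexity_parameterE => //.
- have mE := measurable_bits_eq i j.
  by rewrite -!lee_fin fineK ?fin_num_measure// measure_ge0 probability_le1.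
- exact: coupling_Lfun2.
- exact: coupling_Lfun2.
- by rewrite !quantile_coupling; exact: coupling_product.
Qed.
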